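(* There exists a topological space $X$ such that $X$ has a Lusin $\pi$-base and the square $X\times X$ (with the product topology) has no Lusin $\pi$-base.
   Context: Let $\omega=\{0,1,2,\dots\}$, let ${}^{<\omega}\omega$ be the set of all finite sequences of elements of $\omega$ (including the empty sequence $\langle\rangle$), and let ${}^{\omega}\omega$ be the set of all functions from $\omega$ to $\omega$. For $a\in{}^{<\omega}\omega$ and $n\in\omega$, $a^\frown n$ denotes the sequence $a$ extended by the one further term $n$; for $p\in{}^{\omega}\omega$, $p{\upharpoonright}n$ is the finite sequence $\langle p(0),\dots,p(n-1)\rangle$. A Lusin $\pi$-base for a topological space $X$ is a family $L=\langle L_a\rangle_{a\in{}^{<\omega}\omega}$ of subsets of $X$ such that: (L0) $L_a\supseteq L_{a^\frown n}$ for all $a\in{}^{<\omega}\omega$, $n\in\omega$; (L1) $L_{a^\frown n}\cap L_{a^\frown m}=\varnothing$ for all $a\in{}^{<\omega}\omega$ and $n\neq m$ in $\omega$; (L2) $L_{\langle\rangle}=X$; (L3) $L_a=\bigcup_{n\in\omega}L_{a^\frown n}$ for all $a\in{}^{<\omega}\omega$; (L4) $\bigcap_{n\in\omega}L_{p{\upharpoonright}n}$ is a singleton for every $p\in{}^{\omega}\omega$; (L5) each $L_a$ is open in $X$; (L6) for every point $p\in X$ and every neighbourhood $U$ of $p$ there are $a\in{}^{<\omega}\omega$ and $k\in\omega$ such that $p\in L_a$ and $\bigcup_{j\geq k}L_{a^\frown j}\subseteq U$. *)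

(* Defs.v *)
From mathcomp Require Import all_boot all_classical topology.

Set Implicit Arguments.
Unset Strict Implicit.
Unset Printing Implicit Defensive.

Local Open Scope classical_set_scope.

(* A finite sequence a of naturals is an element of seq nat; the one-term
   extension of a by n is rcons a n, and mkseq p n is the restriction
   [:: p 0; ...; p n.-1] of p : nat -> nat. *)
Record lusin_pi_base (X : topologicalType) (L : seq nat -> set X) : Prop :=
  LusinPiBase {
    lusin_L0 : forall a n, L (rcons a n) `<=` L a ;
    lusin_L1 : forall a n m, n <> m -> L (rcons a n) `&` L (rcons a m) = set0 ;
    lusin_L2 : L [::] = setT ;
    lusin_L3 : forall a, L a = \bigcup_n L (rcons a n) ;
    lusin_L4 : forall p : nat -> nat,
      exists x : X, \bigcap_n L (mkseq p n) = [set x] ;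
    lusin_L5 : forall a, open (L a) ;
    lusin_L6 : forall (x : X) (U : set X), nbhs x U ->
      exists (a : seq nat) (k : nat),
        L a x /\ \bigcup_(j in [set j | (k <= j)%N]) L (rcons a j) `<=` U
  }.

Definition has_lusin_pi_base (X : topologicalType) : Prop :=
  exists L : seq nat -> set X, lusin_pi_base L.

(* Main.v *)
From HB Require Import structures.
Require Import Defs.
From mathcomp Require Import all_boot all_classical topology.
From mathcomp Require Import wochoice zify.

(** A Lusin pi-base identifies a space with Baire space carrying a finer
topology, the members of the base being the cylinders. A way to make cylinders a
Lusin pi-base at a point x is to choose a cofinal set S of levels and to
let every neighbourhood of x contain, at each large level n of S, all but
finitely many of the one-term extensions of the restriction of x to n
([fan_space]). The sets of levels chosen at different points need not be
related in any way, and this is what ruins the square.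

Suppose that M is a Lusin pi-base of the square. Cylinders being a pi-base of
each factor, the open set M_a contains boxes of the ordinary Baire topology; let
W_a be the union of these boxes ([shadow]). The family W is a [box_tree]: a
tree of nonempty sets, open in the product of two Baire spaces, small enough to
enter every box. Such families can be coded by points of Baire space
([decode_onto]), hence there are only continuum many of them, and one can hope
to defeat each of them separately, by the sets of levels attached to the two
coordinates of one well chosen point of the plane.

To defeat W, take a point p = (x, y) that is [generic]: it lies in sets W_b
contained in arbitrarily small boxes around it. Consider the nodes b whose set
W_b contains p. Either, for every level, infinitely
many children of b have points agreeing with x or with y up to this level; then a fast growing f
defining the neighbourhoods of x and y leaves infinitely many children of b
outside the neighbourhood of p ([dominating]). Or almost all children of b
differ from x and from y before some level; generic points have few such b for
each level, so that along a fast sequence N_0 < N_1 < ... the levels at which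
points of the children of b leave x and y lie in a common window
[N_(i-1), N_(i+1)[ ([separation_scale]). Giving the levels N_0, N_4, N_8, ... to
x and N_2, N_6, ... to y, no window meets both sets, so almost all children of b
miss the neighbourhood of p ([dodging_fans]). This refutes the last clause of the
definition of a Lusin pi-base.

The sets of levels have to be chosen for all W at once, so a point of Baire
space may serve one W only, and only as a first or only as a second coordinate.
The generic points of W contain a family indexed by Baire space with pairwise
distinct coordinates ([generic_perfect]); since there are no more trees than
members of this family, a transfinite recursion along a well-order with small
initial segments selects disjoint witnesses ([distinct_representatives]). *)

Set Implicit Arguments.
Unset Strict Implicit.
Unset Printing Implicit Defensive.

Local Open Scope classical_set_scope.

(** * Baire space and finite agreement *)

Notation baire := (nat -> nat).

Definition agree n (x y : baire) := forall i, (i < n)%N -> x i = y i.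

Lemma agree_sym n x y : agree n x y -> agree n y x.
Proof. by move=> xy i /xy. Qed.

Lemma agree_trans n y x z : agree n x y -> agree n y z -> agree n x z.
Proof. by move=> xy yz i ltin; rewrite xy // yz. Qed.

Lemma agreeW m n x y : (m <= n)%N -> agree n x y -> agree m x y.
Proof. by move=> lemn xy i ltim; apply: xy; apply: leq_trans ltim lemn. Qed.

Lemma agreeS n x y : agree n.+1 x y <-> agree n x y /\ x n = y n.
Proof.
split=> [xy|[xy xyn] i]; first by split=> [i ltin|]; apply: xy => //; apply: ltnW.
by rewrite ltnS leq_eqVlt => /predU1P[->|/xy].
Qed.

Lemma agree_mkseq n x y : mkseq x n = mkseq y n <-> agree n x y.
Proof.
split=> [xy i ltin|xy]; last by apply/eq_in_map => i; rewrite mem_iota => /xy.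
by rewrite -(nth_mkseq 0 x ltin) xy nth_mkseq.
Qed.

Lemma mkseq_rcons (x : baire) a n :
  mkseq x (size (rcons a n)) = rcons a n <->
  mkseq x (size a) = a /\ x (size a) = n.
Proof.
rewrite size_rcons mkseqS; split=> [xa|[-> ->]] //.
by case: (rcons_inj xa) => -> ->.
Qed.

Definition upd (x : baire) n c : baire := fun i => if i == n then c else x i.

Lemma agree_upd n x c : agree n (upd x n c) x.
Proof. by move=> i; rewrite /upd; case: eqP => // ->; rewrite ltnn. Qed.

Lemma updE n x c : upd x n c n = c.
Proof. by rewrite /upd eqxx. Qed.

(** * Fan topologies *)

Definition cofinal (S : set nat) := forall m, exists2 n, (m <= n)%N & S n.

(** The basic neighbourhoods of x, without x itself. Once f exceeds x, the level n
of the definition is the first one at which y differs from x. *)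
Definition fan (S : set nat) (f x : baire) r : set baire :=
  [set y | exists n, [/\ (r <= n)%N, S n, agree n y x & (f n <= y n)%N]].

(** The parameter [A] does not occur in the carrier; it only selects the
topology, so that different [A] give different instances. *)
Definition fan_space (A : baire -> set nat) : Type := baire.

Section FanSpace.
Variable A : baire -> set nat.

HB.instance Definition _ := Choice.copy (fan_space A) baire.

Definition fan_open : set_system (fan_space A) :=
  [set U | forall x, U x -> exists f r, fan (A x) f x r `<=` U].

Lemma fan_openT : fan_open setT.
Proof. by move=> x _; exists x, 0. Qed.

Lemma fan_openI : setI_closed fan_open.
Proof.
move=> U V oU oV x [/oU[f [r fU]] /oV[g [s gV]]].
exists (fun n => maxn (f n) (g n)), (maxn r s).
by move=> y [n []]; rewrite !geq_max => /andP[ler les] An yx /andP[lef leg];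
  split; [apply: fU|apply: gV]; exists n.
Qed.

Lemma fan_open_bigU (I : Type) (F : I -> set (fan_space A)) :
  (forall i, fan_open (F i)) -> fan_open (\bigcup_i F i).
Proof.
move=> oF x [i _ /oF[f [r fF]]]; exists f, r => y /fF Fy; by exists i.
Qed.

HB.instance Definition _ :=
  isOpenTopological.Build (fan_space A) fan_openT fan_openI fan_open_bigU.

Lemma fan_openE (U : set (fan_space A)) : open U = fan_open U.
Proof. by []. Qed.

Lemma cylinder_open n x : open ([set y | agree n y x] : set (fan_space A)).
Proof.
rewrite fan_openE => y yx; exists y, n => z [m [lenm _ zy _]].
by apply: agree_trans yx; apply: agreeW zy.
Qed.

(** Fans are open in the Baire topology, which is coarser, so that adding the
centre gives an open set. *)
Lemma fan_nbhs f r x : open ((x |` fan (A x) f x r) : set (fan_space A)).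
Proof.
rewrite fan_openE => y [->|[n [lern An yx lefn]]]; first by exists f, r; right.
exists y, n.+1 => z [m [ltnm _ zy _]]; right.
move/(agreeW ltnm): zy => /agreeS[zy zyn].
by exists n; split; rewrite ?zyn //; apply: agree_trans yx.
Qed.

Hypothesis A_cofinal : forall x, cofinal (A x).

(** The fan topology is finer than the Baire topology but has the same pi-base:
this is what reduces a tree of open sets to countably much information. *)
Lemma open_cylinder (U : set (fan_space A)) x : open U -> U x ->
  exists n y, [set z | agree n z y] `<=` U.
Proof.
rewrite fan_openE => oU /oU[f [r fU]]; have [n lern An] := A_cofinal x r.
exists n.+1, (upd x n (f n)) => z /agreeS[zx zn]; apply: fU.
exists n; split=> //; last by rewrite zn updE.
by apply: agree_trans zx _; apply: agree_upd.
Qed.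

Theorem fan_space_lusin : has_lusin_pi_base (fan_space A).
Proof.
exists (fun a => [set x | mkseq x (size a) = a]); split.
- by move=> a n x /mkseq_rcons[].
- move=> a n m nm; rewrite -subset0 => x [/mkseq_rcons[_ xn] /mkseq_rcons[_ xm]].
  by apply: nm; rewrite -xn.
- by rewrite -subTset => x _.
- move=> a; rewrite predeqE => x; split=> [xa|[n _ /mkseq_rcons[]]] //.
  by exists (x (size a)) => //; apply/mkseq_rcons.
- move=> p; exists p; rewrite predeqE => x; split=> [xp|-> n _].
    apply/funext => i; have := xp i.+1 I.
    by rewrite /mkset size_mkseq => /agree_mkseq; apply.
  by rewrite /mkset size_mkseq.
- move=> a; rewrite fan_openE => x xa; exists x, (size a).
  move=> y [n [len _ yx _]]; rewrite /mkset -[RHS]xa.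
  by apply/agree_mkseq; apply: agreeW yx.
- move=> x U; rewrite nbhsE => -[V [oV Vx] VU].
  rewrite fan_openE in oV; have [f [r fV]] := oV x Vx.
  have [n lern An] := A_cofinal x r; exists (mkseq x n), (f n).
  split; first by rewrite /mkset size_mkseq.
  move=> y [j lefj] /mkseq_rcons[]; rewrite size_mkseq => /agree_mkseq yx yn.
  by apply/VU/fV; exists n; split; rewrite ?yn.
Qed.

End FanSpace.

(** * Distinct representatives *)

(** The order type is made minimal: if in some well-order a proper initial
segment receives an injection of the whole type, the least such segment pulls
back to a well-order without this defect. *)
Lemma small_segment_wellorder (T : choiceType) :
  exists lt : T -> T -> Prop,
    [/\ well_founded lt,
        forall v w, v <> w -> lt v w \/ lt w v &
        forall w (e : T -> T), injective e -> exists t, ~ lt (e t) w].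
Proof.
have [le le_wo] := well_ordering_principle T.
have le_min (P : T -> Prop) : (exists x, P x) ->
    exists2 z, P z & forall x, P x -> le z x.
  move=> [x Px]; have [|z [[/asboolP Pz zmin] _]] := le_wo (fun x => `[<P x>]).
    by exists x; apply/asboolP.
  by exists z => // y Py; apply: zmin; apply/asboolP.
have le_anti x y : le x y -> le y x -> x = y.
  move=> xy yx; have [|z [_ zu]] := le_wo (pred2 x y).
    by exists x; rewrite inE eqxx.
  have le_xx t : le t t.
    by have [|u -> umin] := le_min (fun s => s = t); [exists t|apply: umin].
  by transitivity z; [apply/esym|]; apply: zu; split;
    rewrite ?inE ?eqxx ?orbT // => t /pred2P[]->.
pose lt x y := le x y /\ x <> y.
have lt_total x y : x <> y -> lt x y \/ lt y x.
  move=> xy; have [|z [] -> zmin] := le_min (fun z => z = x \/ z = y).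
  - by exists x; left.
  - by left; split=> //; apply: zmin; right.
  - by right; split=> [|/esym //]; apply: zmin; left.
have lt_wf : well_founded lt.
  move=> x; apply: contrapT => nacc.
  have [|z nz zmin] := le_min (fun t => ~ Acc lt t); first by exists x.
  apply: nz; constructor => y [yz neq]; apply: contrapT => /zmin zy.
  exact/neq/le_anti.
have [small|] := pselect (forall w (e : T -> T), injective e ->
    exists t, ~ lt (e t) w); first by exists lt.
move=> /existsNP/le_min[w0 /existsNP[e /not_implyP[e_inj /forallNP e_lt]] w0min].
exists (fun x y => lt (e x) (e y)); split.
- move=> x; have [y] : exists y, y = e x by exists (e x).
  elim/(well_founded_ind lt_wf): y x => y IH x yE; constructor=> z.
  by rewrite -yE => /IH; apply.
- by move=> v w vw; apply: lt_total => /e_inj.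
- move=> w g g_inj; apply: contrapT => /forallNP gw.
  have [ew_le ew_ne] : lt (e w) w0 by apply: contrapT; apply: e_lt.
  apply/ew_ne/le_anti => //; apply: w0min => /(_ (e \o g))[].
    exact: inj_comp.
  by move=> t; apply; apply: contrapT; apply: gw.
Qed.

(** By recursion along a well-order with small initial segments, the
representative of w has to avoid the values of x and of y already used. If every
candidate met one of them, then so would every candidate [pair (r1, r2)]: either
for some r1 all r2 clash through y, or for each r1 some r2 clashes through x,
and each case injects the whole type into the initial segment of w. *)
Lemma distinct_representatives (T : choiceType) (X Y : Type)
    (pair : T * T -> T) (x : T -> T -> X) (y : T -> T -> Y) :
  injective pair -> (forall w, injective (x w)) -> (forall w, injective (y w)) ->
  exists rho : T -> T, forall v w, v <> w ->
    x v (rho v) <> x w (rho w) /\ y v (rho v) <> y w (rho w).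
Proof.
move=> pair_inj x_inj y_inj.
have [lt [lt_wf lt_total small]] := small_segment_wellorder T.
have fresh w (rec : T -> T) : exists r, forall v, lt v w ->
    x v (rec v) <> x w r /\ y v (rec v) <> y w r.
  apply: contrapT => /forallNP clash.
  have {}clash r : exists v, lt v w /\
      (x v (rec v) = x w r \/ y v (rec v) = y w r).
    have /existsNP[v /not_implyP[vw]] := clash r.
    by move=> /not_andP[|] /contrapT; exists v; split=> //; [left|right].
  have [[r1 yclash]|/forallNP xclash] := pselect (exists r1, forall r2, exists v,
      lt v w /\ y v (rec v) = y w (pair (r1, r2))).
    have [e eP] := choice yclash; have [|r2] := small w e; last by case: (eP r2).
    move=> r r' err; have [_ yr] := eP r; have [_] := eP r'.
    by rewrite -err yr => /y_inj/pair_inj[].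
  have {}xclash r1 : exists v r2, lt v w /\ x v (rec v) = x w (pair (r1, r2)).
    have /existsNP[r2 /forallNP ny] := xclash r1.
    have [v [vw [xv|yv]]] := clash (pair (r1, r2)); first by exists v, r2.
    by case: (ny v).
  have [e eP] := choice xclash; have [|r1] := small w e.
    move=> r r' err; have [r2 [_ xr]] := eP r; have [r2' [_]] := eP r'.
    by rewrite -err xr => /x_inj/pair_inj[].
  by have [r2 []] := eP r1.
(* The default value w is never used below: [fresh] only reads [rec] under w. *)
pose F w (rec : forall v, lt v w -> T) :=
  projT1 (cid (fresh w (fun v => if pselect (lt v w) is left vw then rec v vw else w))).
have FE w : Fix lt_wf (fun=> T) F w = F w (fun v _ => Fix lt_wf (fun=> T) F v).
  apply: (Fix_eq lt_wf (fun=> T)) => t f g fg; rewrite /F; congr (projT1 (cid (fresh _ _))).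
  by apply/funext => v; case: pselect.
exists (Fix lt_wf (fun=> T) F) => v w /lt_total.
wlog vw : v w / lt v w => [IH [vw|wv]|_].
- by apply: IH => //; left.
- by have [|? ?] := IH _ _ wv; [left|split; apply/nesym].
rewrite (FE w) /F; case: cid => r /= /(_ v vw); case: pselect => //.
Qed.

(** * Box trees and their generic points *)

Definition box n (p : baire * baire) : set (baire * baire) :=
  [set q | agree n q.1 p.1 /\ agree n q.2 p.2].

Lemma box_refl n p : box n p p. Proof. by []. Qed.

Lemma box_sub m n p q : (m <= n)%N -> box n p q -> box n q `<=` box m p.
Proof.
move=> lemn [q1 q2] r [r1 r2].
by split; apply: agreeW lemn _; apply: agree_trans; eassumption.
Qed.

Lemma box_sym n p q : box n p q -> box n q p.
Proof. by move=> [? ?]; split; apply: agree_sym. Qed.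

(** What remains of a Lusin pi-base of the square when its members are replaced
by their interiors for the product of two Baire topologies. *)
Record box_tree (W : seq nat -> set (baire * baire)) : Prop := BoxTree {
  bt_nonempty : forall a, W a !=set0 ;
  bt_open : forall a p, W a p -> exists n, box n p `<=` W a ;
  bt_mono : forall a b, prefix a b -> W b `<=` W a ;
  bt_comparable : forall a b p, W a p -> W b p -> prefix a b \/ prefix b a ;
  bt_pi : forall n p, exists a, W a `<=` box n p }.

(** A comeager condition on p, for a given box tree: p belongs, for each n, to
the dense open union of those sets of the tree that are contained in boxes of
level n. *)
Definition generic (W : seq nat -> set (baire * baire)) p :=
  forall n, exists2 a, W a p & W a `<=` box n p.

(** One step of the fusion. The term c is written at place n in both
coordinates before the pi-base property is used, so it can be chosen freely. *)
Lemma generic_step W n p c : box_tree W -> exists m q,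
  [/\ (n < m)%N, box n p q, q.1 n = c, q.2 n = c &
      exists2 a, box m q `<=` W a & W a `<=` box n p].
Proof.
move=> tW; pose p' := (upd p.1 n c, upd p.2 n c).
have [a sub_a] := bt_pi tW n.+1 p'; have [q Wq] := bt_nonempty tW a.
have [m sub_m] := bt_open tW Wq.
have [/agreeS[q1 q1n] /agreeS[q2 q2n]] := sub_a q Wq.
have p'p : box n p p' by split; apply: agree_upd.
exists (maxn m n.+1), q; split.
- by rewrite leq_max leqnn orbT.
- by apply: (box_sub (leqnn n) p'p); split.
- by rewrite q1n /= updE.
- by rewrite q2n /= updE.
- exists a; last first.
    by move=> r /sub_a[/agreeS[r1 _] /agreeS[r2 _]]; apply: (box_sub (leqnn n) p'p); split.
  by move=> r br; apply: sub_m; apply: (box_sub (leq_maxl m n.+1)) br.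
Qed.

(** Iterating the previous step with the terms of r as free choices gives a
generic point from either coordinate of which r can be read off: the place where
the k-th term of r is written depends on the earlier terms only. *)
Lemma generic_perfect W (p0 : baire * baire) : box_tree W ->
  exists phi : baire -> baire * baire,
    [/\ injective (fun r => (phi r).1), injective (fun r => (phi r).2),
        forall r, box 1 p0 (phi r) & forall r, generic W (phi r)].
Proof.
move=> tW.
have /choice[step stepP] : forall sc : nat * (baire * baire) * nat, exists s',
    [/\ (sc.1.1 < s'.1)%N, box sc.1.1 sc.1.2 s'.2,
        s'.2.1 sc.1.1 = sc.2, s'.2.2 sc.1.1 = sc.2 &
        exists2 a, box s'.1 s'.2 `<=` W a & W a `<=` box sc.1.1 sc.1.2].
  move=> [[n p] c]; have [m [q mqP]] := generic_step n p c tW.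
  by exists (m, q).
pose st (r : baire) := fix st k := if k is k'.+1 then step (st k', r k') else (1, p0).
have st_lt r k : ((st r k).1 < (st r k.+1).1)%N by case: (stepP (st r k, r k)).
have st_ge r k : (k < (st r k).1)%N by elim: k => // k /leq_ltn_trans; apply.
have st_box r j k : (j <= k)%N -> box (st r j).1 (st r j).2 (st r k).2.
  move=> /subnK <-; elim: (k - j) => [|d IH] //.
  have [_ [s1 s2] _ _ _] := stepP (st r (d + j), r (d + j)).
  have le_d : ((st r j).1 <= (st r (d + j)).1)%N.
    by elim: d {IH s1 s2} => // d IH; apply: leq_trans IH (ltnW (st_lt _ _)).
  by apply: (box_sub (leqnn _) IH); split; apply: agreeW le_d _.
pose phi r : baire * baire :=
  ((fun i => (st r i.+1).2.1 i), (fun i => (st r i.+1).2.2 i)).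
have phi_box r k : box (st r k).1 (st r k).2 (phi r).
  suff E i : (i < (st r k).1)%N -> (st r i.+1).2.1 i = (st r k).2.1 i /\
      (st r i.+1).2.2 i = (st r k).2.2 i by split=> i /E[].
  move=> ltik; have [lei|/ltnW lek] := leqP k i.+1.
    by have [e1 e2] := st_box r _ _ lei; rewrite e1 ?e2.
  have lti := ltnW (st_ge r i.+1).
  by have [e1 e2] := st_box r _ _ lek; rewrite -e1 -?e2.
have phiE r k : (phi r).1 (st r k).1 = r k /\ (phi r).2 (st r k).1 = r k.
  have [_ _ e1 e2 _] := stepP (st r k, r k).
  by have [-> // -> //] := phi_box r k.+1.
(* The induction hypothesis is that both constructions are in the same state. *)
have digits_inj r r' : (forall k, st r k = st r' k -> r k = r' k) -> r = r'.
  move=> eq_digit; apply/funext => k; apply: (eq_digit).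
  by elim: k => //= k IH; rewrite IH (eq_digit k IH).
exists phi; split.
- move=> r r' e; apply: digits_inj => k Ek.
  by rewrite -(phiE r k).1 -(phiE r' k).1 e Ek.
- move=> r r' e; apply: digits_inj => k Ek.
  by rewrite -(phiE r k).2 -(phiE r' k).2 e Ek.
- by move=> r; apply: (phi_box r 0).
- move=> r n; have [_ _ _ _ [a sub_a a_sub]] := stepP (st r n, r n).
  exists a; first exact/sub_a/(phi_box r n.+1).
  move=> q /a_sub [q1 q2]; apply: (box_sub (ltnW (st_ge r n)) _ _).
    exact/box_sym/phi_box.
  by split.
Qed.

(** * Fans dodging a box tree *)

(** Diagonalisation: each of the functions h i j is eventually below f, from a
place on that depends on i and j in a known way. *)
Lemma dominating (h : nat -> nat -> nat -> nat) :
  exists f : baire, forall i j d, (i <= d)%N -> (j <= d)%N -> (h i j d < f d)%N.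
Proof.
exists (fun d => (\max_(i < d.+1) \max_(j < d.+1) h i j d).+1) => i j d.
rewrite -ltnS => ltid; rewrite -ltnS => ltjd; rewrite ltnS.
apply: leq_trans (leq_bigmax (Ordinal ltid)).
exact: (leq_bigmax (F := fun j : 'I_d.+1 => h i j d) (Ordinal ltjd)).
Qed.

Lemma box_perturb W a p q n : box_tree W -> W a q ->
  exists q', [/\ W a q', q'.1 <> p.1, q'.2 <> p.2 & box n q q'].
Proof.
move=> tW /(bt_open tW)[m sub].
pose k := maxn m n.
pose q' := (upd q.1 k (p.1 k).+1, upd q.2 k (p.2 k).+1).
have kq : box k q q' by split; apply: agree_upd.
exists q'; split.
- by apply: sub; apply: (box_sub (leq_maxl m n)) kq.
- by move/(congr1 (@^~ k)); rewrite /= updE; lia.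
- by move/(congr1 (@^~ k)); rewrite /= updE; lia.
- by apply: (box_sub (leq_maxr m n)) kq.
Qed.

Definition apart_below W b (p : baire * baire) m := exists k, forall l q,
  (k <= l)%N -> W (rcons b l) q -> ~ agree m q.1 p.1 /\ ~ agree m q.2 p.2.


Lemma apart_belowW W b p m n : (m <= n)%N -> apart_below W b p m -> apart_below W b p n.
Proof.
move=> lemn [k sep]; exists k => l q lekl Wq.
by have [s1 s2] := sep l q lekl Wq; split=> /(agreeW lemn).
Qed.

(** Levels N at which each node b around p lives in one short window: the points
of W_b agree with p up to N (i - 1), and almost all children of b have left p by
N (i + 1). The step from N i to N (i + 1) has to bound the separation levels of
all nodes b around p with W_b not inside the box of level N i. They are
initial segments of any node c around p with W_c inside this box, hence
finitely many. *)
Lemma separation_scale W p : box_tree W -> generic W p ->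
  exists N : nat -> nat, (forall i, N i < N i.+1)%N /\
    forall b, W b p -> (exists m, apart_below W b p m) ->
      exists i, apart_below W b p (N i.+1) /\
        forall j, (j < i)%N -> W b `<=` box (N j) p.
Proof.
move=> tW genp.
have /choice[bnd bndP] b : exists m, (exists m, apart_below W b p m) -> apart_below W b p m.
  have [[m sep]|nsep] := pselect (exists m, apart_below W b p m); first by exists m.
  by exists 0.
have /choice[next nextP] r : exists n, (r < n)%N /\ forall b, W b p ->
    ~ (W b `<=` box r p) -> (bnd b <= n)%N.
  have [c Wc c_sub] := genp r.
  exists (maxn r.+1 (\max_(i < (size c).+1) bnd (take i c))).
  split=> [|b Wb bsub]; first by rewrite leq_max leqnn.
  have [/prefixP[c' cE]|cb] := bt_comparable tW Wb Wc; last first.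
    by case: bsub; apply: subset_trans (bt_mono tW cb) c_sub.
  have ltb : (size b < (size c).+1)%N by rewrite cE size_cat ltnS leq_addr.
  rewrite leq_max; apply/orP; right.
  have := leq_bigmax (F := fun i : 'I_(size c).+1 => bnd (take i c)) (Ordinal ltb).
  by rewrite /= {1}cE take_size_cat.
pose N := fix N i := if i is i'.+1 then next (N i') else 0.
have N_lt i : (N i < N i.+1)%N by case: (nextP (N i)).
have N_ge i : (i <= N i)%N by elim: i => // i IH; apply: leq_ltn_trans IH _.
exists N; split=> // b Wb sep.
have out : exists i, `[< ~ (W b `<=` box (N i) p) >].
  have [q [Wq q1 _ _]] := box_perturb p 0 tW Wb.
  have /existsNP[n qn] : ~ forall n, q.1 n = p.1 n by move=> /funext.
  exists n.+1; apply/asboolP => /(_ q Wq)[+ _]; move/(_ n (N_ge n.+1)).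
  exact: qn.
case: (ex_minnP out) => i /asboolP outi imin; exists i; split.
  by apply: apart_belowW (bndP b sep); apply: (nextP (N i)).2.
move=> j ltji; apply: contrapT => /asboolP /imin; lia.
Qed.

Lemma fan_first S (f x : baire) r y : (forall n, x n < f n)%N -> fan S f x r y ->
  exists n, [/\ (r <= n)%N, S n, agree n y x, (f n <= y n)%N &
    forall m, agree m y x -> (m <= n)%N].
Proof.
move=> xf [n [lern Sn yx fy]]; exists n; split=> // m yxm.
rewrite leqNgt; apply/negP => /yxm yxn.
by have := xf n; rewrite -yxn ltnNge fy.
Qed.

Definition dodges (W : seq nat -> set (baire * baire)) p S T f :=
  forall b k, W b p -> exists l q,
    [/\ (k <= l)%N, W (rcons b l) q &
      ~ ((p.1 |` fan S f p.1 0) q.1 /\ (p.2 |` fan T f p.2 0) q.2)].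

(** Nodes almost all of whose children leave both coordinates of p before some
fixed level are handled by the choice of S and T: the first
coordinate may use the levels N (4 u), the second one the levels N (4 v + 2), and
no window between N (i - 1) and N (i + 1) contains one of each. The other nodes
have children arbitrarily close to x or y, and f is made to grow faster than
points of these children at the place where they leave x or y. *)
Lemma dodging_fans W p : box_tree W -> generic W p -> exists S T f,
  [/\ cofinal S, cofinal T & dodges W p S T f].
Proof.
move=> tW genp; have [N [N_lt NP]] := separation_scale tW genp.
have N_mono : {mono N : i j / (i <= j)%N}.
  by apply: leq_mono; apply: homo_ltn => //; apply: ltn_trans.
have N_ge i : (i <= N i)%N by elim: i => // i IH; apply: leq_ltn_trans IH _.
have /choice[g gP] (bm : seq nat * nat) : exists q, W bm.1 p ->
    ~ (exists m, apart_below W bm.1 p m) -> exists2 l, (bm.2 <= l)%N &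
    [/\ W (rcons bm.1 l) q, q.1 <> p.1, q.2 <> p.2 &
        agree bm.2 q.1 p.1 \/ agree bm.2 q.2 p.2].
  case: bm => b m /=; have [Wb|] := pselect (W b p); last by exists p.
  have [//|/forallNP/(_ m)/forallNP/(_ m)] := pselect (exists m, apart_below W b p m).
    by exists p.
  move=> /existsNP[l /existsNP[q /not_implyP[leml /not_implyP[Wq nsep]]]].
  (* The witness is moved off p, so that it leaves x and y at definite levels. *)
  have [q' [Wq' q'1 q'2 [qq1 qq2]]] := box_perturb p m tW Wq.
  exists q' => _ _; exists l => //; split=> //.
  move/not_andP: nsep => [|] /contrapT qp; [left|right];
    by apply: agree_trans qp.
pose h i j d : nat := maxn (maxn (p.1 d) (p.2 d))
  (if unpickle i is Some b then maxn ((g (b, j)).1 d) ((g (b, j)).2 d) else 0).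
have [f fP] := dominating h.
have f_p d : (p.1 d < f d)%N /\ (p.2 d < f d)%N.
  by have := fP 0 0 d (leq0n _) (leq0n _); rewrite /h; lia.
have f_p1 d : (p.1 d < f d)%N by case: (f_p d).
have f_p2 d : (p.2 d < f d)%N by case: (f_p d).
have f_g b m d : (pickle b <= d)%N -> (m <= d)%N ->
    ((g (b, m)).1 d < f d)%N /\ ((g (b, m)).2 d < f d)%N.
  by move=> leb lem; have := fP _ _ _ leb lem; rewrite /h pickleK; lia.
exists [set N (4 * i) | i in setT], [set N (4 * i + 2) | i in setT], f; split.
- by move=> m; exists (N (4 * m)) => //; have := N_ge (4 * m); lia.
- by move=> m; exists (N (4 * m + 2)) => //; have := N_ge (4 * m + 2); lia.
move=> b k Wb; have [sep|nsep] := pselect (exists m, apart_below W b p m).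
  have [i [[k' sepi] near]] := NP b Wb sep.
  pose l := maxn k k'; have [q Wq] := bt_nonempty tW (rcons b l).
  have [a1 a2] := sepi l q (leq_maxr _ _) Wq.
  exists l, q; split; rewrite ?leq_maxl // => -[q1 q2].
  have Wbq := bt_mono tW (prefix_rcons _ _) Wq.
  case: q1 => [q1|/(fan_first f_p1)[n [_ [u _ <-] qu _ u_max]]].
    by case: a1; rewrite q1.
  case: q2 => [q2|/(fan_first f_p2)[n' [_ [v _ <-] qv _ v_max]]].
    by case: a2; rewrite q2.
  have ltu : (4 * u < i.+1)%N.
    by rewrite ltnNge -N_mono; apply/negP => /agreeW/(_ qu).
  have ltv : (4 * v + 2 < i.+1)%N.
    by rewrite ltnNge -N_mono; apply/negP => /agreeW/(_ qv).
  case: i => [|i] in near sepi a1 a2 ltu ltv *; first by lia.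
  have [/u_max + /v_max] := near i (leqnn _) q Wbq; rewrite !N_mono; lia.
(* From level [pickle b] on, f dominates the witnesses chosen for b. *)
pose m := maxn k (pickle b).
have [l leml [Wq q1 q2 qp]] := gP (b, m) Wb nsep.
exists l, (g (b, m)); split=> //; first by apply: leq_trans leml; apply: leq_maxl.
move=> [[//|/(fan_first f_p1)[u [_ _ _ lefu u_max]]]].
move=> [//|/(fan_first f_p2)[v [_ _ _ lefv v_max]]].
have lebm : (pickle b <= m)%N by apply: leq_maxr.
case: qp => [/u_max|/v_max] lem; have [f1 f2] := f_g b m _ (leq_trans lebm lem) lem.
  by rewrite ltnNge lefu in f1.
by rewrite ltnNge lefv in f2.
Qed.

(** * From a Lusin pi-base of the square to a box tree *)

Section LusinTree.
Context {X : topologicalType} {L : seq nat -> set X}.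
Hypothesis lusinL : lusin_pi_base L.

Lemma lusin_mono a b : prefix a b -> L b `<=` L a.
Proof.
move=> /prefixP[c ->]; elim/last_ind: c => [|c n IH]; first by rewrite cats0.
by rewrite -rcons_cat; apply: subset_trans IH; apply: lusin_L0.
Qed.

Lemma lusin_nonempty a : L a !=set0.
Proof.
have [x xE] := lusin_L4 lusinL (nth 0 a); exists x.
have /(_ (size a) I) : (\bigcap_n L (mkseq (nth 0 a) n)) x by rewrite xE.
by rewrite mkseq_nth.
Qed.

Lemma lusin_comparable a b x : L a x -> L b x -> prefix a b \/ prefix b a.
Proof.
elim/last_ind: a => [|a n IH] Lanx Lbx; first by left; apply: prefix0s.
have [/prefixP[[|m c] bE]|ba] := IH (lusin_L0 lusinL Lanx) Lbx.
- by right; rewrite bE cats0 prefix_rcons.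
- have [<-|nm] := pselect (m = n).
    by left; rewrite bE -cat_rcons prefix_prefix.
  have Lamx : L (rcons a m) x.
    by apply: lusin_mono Lbx; rewrite bE -cat_rcons prefix_prefix.
  by have : (L (rcons a m) `&` L (rcons a n)) x by []; rewrite (lusin_L1 lusinL).
- by right; apply: prefix_trans ba (prefix_rcons _ _).
Qed.

End LusinTree.

Definition shadow (M : seq nat -> set (baire * baire)) a : set (baire * baire) :=
  [set p | exists n, box n p `<=` M a].

Lemma shadow_sub M a : shadow M a `<=` M a.
Proof. by move=> p [n]; apply; apply: box_refl. Qed.

Section SquareBoxes.
Variable A : baire -> set nat.
Hypothesis A_cofinal : forall x, cofinal (A x).
Local Notation square := (fan_space A * fan_space A)%type.

Lemma box_open n p : open (box n p : set square).
Proof.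
rewrite openE => q [q1 q2].
exists ([set y | agree n y p.1], [set y | agree n y p.2]) => //.
by split; apply: open_nbhs_nbhs; split=> //; apply: cylinder_open.
Qed.

Lemma open_box (O : set square) p : open O -> O p ->
  exists n q, box n q `<=` (O : set (baire * baire)).
Proof.
rewrite openE => oO /oO[[U V] /= []].
rewrite !nbhsE => -[U' [oU Up] UU] [V' [oV Vp] VV] UVO.
have [n [x xU]] := open_cylinder A_cofinal oU Up.
have [m [y yV]] := open_cylinder A_cofinal oV Vp.
exists (maxn n m), (x, y) => q [q1 q2]; apply: UVO; split.
  by apply/UU/xU; apply: agreeW q1; apply: leq_maxl.
by apply/VV/yV; apply: agreeW q2; apply: leq_maxr.
Qed.

Variable M : seq nat -> set square.
Hypothesis lusinM : lusin_pi_base M.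

Lemma shadow_box_tree : box_tree (shadow M).
Proof.
split.
- move=> a; have [p Mp] := lusin_nonempty lusinM a.
  have [n [q sub]] := open_box (lusin_L5 lusinM a) Mp.
  by exists q, n.
- move=> a p [n sub]; exists n => q pq; exists n.
  by apply: subset_trans sub; apply: box_sub.
- by move=> a b ab p [n sub]; exists n; apply: subset_trans sub (lusin_mono lusinM ab).
- by move=> a b p /shadow_sub Ma /shadow_sub Mb; apply: lusin_comparable lusinM _ _ _ Ma Mb.
- move=> n p; have nb : nbhs (p : square) (box n p : set square).
    by apply: open_nbhs_nbhs; split; [apply: box_open|apply: box_refl].
  have [a [k [_ sub]]] := lusin_L6 lusinM nb.
  by exists (rcons a k) => q /shadow_sub Mq; apply: sub; exists k => /=.
Qed.

(** At generic points the shadow sees the whole branch of M: a node around p in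
the shadow that is too small to be a proper initial segment of b extends b. *)
Lemma generic_shadow p b : generic (shadow M) p -> M b p -> shadow M b p.
Proof.
move=> genp Mb; have tM := shadow_box_tree.
have [q0 Sq0] := bt_nonempty tM b.
have [q [Sq q1 _ _]] := box_perturb p 0 tM Sq0.
have /existsNP[n qn] : ~ forall n, q.1 n = p.1 n by move=> /funext.
have [c Sc c_sub] := genp n.+1.
have [bc|cb] := lusin_comparable lusinM Mb (shadow_sub Sc).
  exact: bt_mono bc _ Sc.
by have [/(_ n (leqnn _))] := c_sub q (bt_mono tM cb Sq).
Qed.

End SquareBoxes.

(** * One topology against all box trees *)

(** The nonzero terms of w enumerate the boxes, given by pairs of finite
sequences of equal length, whose union is the set of index a. *)
Definition decode (w : baire) (a : seq nat) : set (baire * baire) :=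
  [set p | exists n, w (pickle (a, (mkseq p.1 n, mkseq p.2 n))) != 0].

Lemma decode_onto W : box_tree W -> exists w, decode w = W.
Proof.
move=> tW.
exists (fun k => if unpickle k is Some (a, (s, t)) then
   nat_of_bool `[< forall q : baire * baire,
     mkseq q.1 (size s) = s -> mkseq q.2 (size t) = t -> W a q >] else 0).
apply/funext => a; rewrite predeqE => p; split=> [[n]|/(bt_open tW)[n sub]].
  rewrite pickleK; case: asboolP => // H _; apply: H; by rewrite size_mkseq.
exists n; rewrite pickleK; case: asboolP => // -[] q; rewrite !size_mkseq.
by move=> /agree_mkseq q1 /agree_mkseq q2; apply: sub.
Qed.

Definition interleave (xy : baire * baire) : baire :=
  fun n => if odd n then xy.2 n./2 else xy.1 n./2.

Lemma interleave_inj : injective interleave.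
Proof.
move=> [x y] [x' y'] e; congr pair; apply/funext => n.
  by have := congr1 (@^~ n.*2) e; rewrite /interleave /= odd_double doubleK.
have := congr1 (@^~ n.*2.+1) e.
by rewrite /interleave /= odd_double /= uphalf_double.
Qed.

(** The witnesses of different trees have different first and different second
coordinates, so the levels that each witness needs at its coordinates can be
prescribed simultaneously. *)
Lemma levels_against_box_trees : exists A : baire -> set nat,
  (forall x, cofinal (A x)) /\ forall W, box_tree W -> exists p f,
    generic W p /\ dodges W p (A p.1) (A p.2) f.
Proof.
(* First coordinates start with 0 and second ones with 1, so they never clash. *)
pose p0 : baire * baire := (fun=> 0, fun=> 1).
have /choice[phi phiP] w : exists phi : baire -> baire * baire,
    [/\ injective (fun r => (phi r).1), injective (fun r => (phi r).2),
        forall r, box 1 p0 (phi r) &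
        forall r, box_tree (decode w) -> generic (decode w) (phi r)].
  have [tW|] := pselect (box_tree (decode w)); last first.
    (* The selection runs through all w, also those that code no tree. *)
    pose start c (r : baire) : baire := fun n => if n is m.+1 then r m else c.
    have start_inj c : injective (start c).
      by move=> r r' e; apply/funext => m; have := congr1 (@^~ m.+1) e.
    exists (fun r => (start 0 r, start 1 r)); split=> //.
    - exact: start_inj.
    - exact: start_inj.
    - by move=> r; split=> -[].
  have [phi [phi1 phi2 phi0 phig]] := generic_perfect p0 tW.
  by exists phi; split.
have phi_inj1 w : injective (fun r => (phi w r).1) by case: (phiP w).
have phi_inj2 w : injective (fun r => (phi w r).2) by case: (phiP w).
have [rho rhoP] := distinct_representatives interleave_inj phi_inj1 phi_inj2.
pose pt w := phi w (rho w).
have pt0 w : (pt w).1 0 = 0 /\ (pt w).2 0 = 1.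
  by have [_ _ /(_ (rho w)) [-> // -> //] _] := phiP w.
have /choice[STf STfP] w : exists STf : set nat * set nat * baire,
    [/\ cofinal STf.1.1, cofinal STf.1.2 &
    box_tree (decode w) -> dodges (decode w) (pt w) STf.1.1 STf.1.2 STf.2].
  have [tW|] := pselect (box_tree (decode w)); last first.
    by exists (setT, setT, fun=> 0); split=> // m; exists m.
  have [_ _ _ /(_ (rho w) tW) genw] := phiP w.
  by have [S [T [f [? ? ?]]]] := dodging_fans tW genw; exists (S, T, f).
have /choice[A AP] x : exists S, cofinal S /\ forall w,
    (x = (pt w).1 -> S = (STf w).1.1) /\ (x = (pt w).2 -> S = (STf w).1.2).
  have [[w xw]|nx1] := pselect (exists w, x = (pt w).1).
    exists (STf w).1.1; split=> [|v]; first by case: (STfP w).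
    split=> xv.
      have [-> //|/rhoP[e _]] := pselect (w = v).
      by case: e; rewrite -/(pt w) -/(pt v) -xw xv.
    by have := (pt0 w).1; rewrite -xw xv (pt0 v).2.
  have [[w xw]|nx2] := pselect (exists w, x = (pt w).2).
    exists (STf w).1.2; split=> [|v]; first by case: (STfP w).
    split=> xv; first by case: nx1; exists v.
    have [-> //|/rhoP[_ e]] := pselect (w = v).
    by case: e; rewrite -/(pt w) -/(pt v) -xw xv.
  exists setT; split=> [m|w]; first by exists m.
  by split=> xw; [case: nx1|case: nx2]; exists w.
exists A; split=> [x|W tW]; first by case: (AP x).
have [w wW] := decode_onto tW; exists (pt w), (STf w).2.
have [_ _ _ /(_ (rho w))] := phiP w; have [_ _] := STfP w; rewrite wW.
move=> /(_ tW) dodge /(_ tW) genw; split=> //.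
by rewrite ((AP (pt w).1).2 w).1 // ((AP (pt w).2).2 w).2.
Qed.

(** The point p and the function f defeating the shadow of M give a neighbourhood
of p that violates the last clause for every node. *)
Lemma square_not_lusin (A : baire -> set nat) :
  (forall x, cofinal (A x)) ->
  (forall W, box_tree W -> exists p f,
     generic W p /\ dodges W p (A p.1) (A p.2) f) ->
  ~ has_lusin_pi_base (fan_space A * fan_space A)%type.
Proof.
move=> A_cofinal A_dodges [M lusinM].
have [p [f [genp dodge]]] := A_dodges _ (shadow_box_tree A_cofinal lusinM).
pose U (x : fan_space A) : set (fan_space A) := x |` fan (A x) f x 0.
have nbU x : nbhs x (U x).
  by apply: open_nbhs_nbhs; split; [apply: fan_nbhs|left].
have nb : nbhs (p : fan_space A * fan_space A) (U p.1 `*` U p.2).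
  by exists (U p.1, U p.2).
have [b [k [Mb sub]]] := lusin_L6 lusinM nb.
have [l [q [lekl Sq]]] := dodge b k (generic_shadow A_cofinal lusinM genp Mb).
by apply; apply: sub; exists l => //; apply: shadow_sub.
Qed.

(* X * X carries the library's product topology. *)
Theorem theorem25 :
  exists X : topologicalType,
    has_lusin_pi_base X /\ ~ has_lusin_pi_base (X * X)%type.
Proof.
have [A [A_cofinal A_dodges]] := levels_against_box_trees.
exists (fan_space A); split; first exact: fan_space_lusin.
exact: square_not_lusin.
Qed.
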